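(* Given $\beta>1$, the beta-shift $\mathsf{X}_\beta$ is sofic if and only if the generating sequence $g(\beta)$ is eventually periodic. In that case, for minimal $n\ge 0$, $p\ge 1$ with $g(\beta)=g_1\cdots g_n(g_{n+1}\cdots g_{n+p})^\infty$, the right Fischer cover of $\mathsf{X}_\beta$ is the labelled graph $(F_\beta,\mathcal{L}_\beta)$ with vertices $F_\beta^0=\{v_1,\ldots,v_{n+p}\}$, edges $F_\beta^1=\{e_i^k\mid 1\le i\le n+p,\ 0\le k\le g_i\}$, and $$s(e_i^k)=v_i,\qquad r(e_i^k)=\begin{cases}v_1,& k<g_i\\ v_{i+1},& k=g_i,\ i<n+p\\ v_{n+1},& k=g_{n+p},\ i=n+p\end{cases},\qquad \mathcal{L}_\beta(e_i^k)=k .$$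
   Context: Let $\beta>1$. For $t\in[0,1]$ put $r_1(t)=\langle\beta t\rangle$, $x_1(t)=\lfloor\beta t\rfloor$, $r_n(t)=\langle\beta r_{n-1}(t)\rangle$, $x_n(t)=\lfloor\beta r_{n-1}(t)\rfloor$ ($\lfloor\cdot\rfloor$ integer part, $\langle\cdot\rangle$ fractional part). The sequence $x_1(t)x_2(t)\cdots$ is the $\beta$-expansion of $t$, and $e(\beta)$ is the $\beta$-expansion of $1$; it is finite if its terms are eventually $0$. The generating sequence is $g(\beta)=e(\beta)$ if $e(\beta)$ is not finite, and $g(\beta)=(a_1\cdots a_{k-1}(a_k-1))^\infty$ if $e(\beta)=a_1\cdots a_k00\cdots$ with $a_k\ne0$. The beta-shift $\mathsf{X}_\beta$ is the two-sided shift space whose language is the set of finite factors of $\beta$-expansions of $t\in[0,1)$, over the alphabet $\{0,\ldots,\lceil\beta\rceil-1\}$; equivalently (Rényi) $x\in\mathsf{X}_\beta$ iff $x_kx_{k+1}\cdots\le g(\beta)$ lexicographically for all $k\in\mathbb{Z}$. Beta-shifts are irreducible. A shift space is sofic if it is the set of label sequences of biinfinite paths in a finite labelled graph (a presentation). A presentation is right-resolving if no vertex emits two edges with the same label. The right Fischer cover of an irreducible sofic shift is its right-resolving presentation with the minimal number of vertices, unique up to labelled graph isomorphism. *)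

(* Defs.v *)
From HB Require Import structures.
From mathcomp Require Import all_boot all_order all_algebra.
From mathcomp Require Import all_classical all_reals.

Set Implicit Arguments.
Unset Strict Implicit.
Unset Printing Implicit Defensive.

Import Order.TTheory GRing.Theory Num.Theory.
Local Open Scope classical_set_scope.
Local Open Scope ring_scope.

(* One-sided sequences are indexed from 0: the term a_i of the mathematical
   text is [a i.-1].  Digits are natural numbers. *)

Section BetaExpansion.
Context {R : realType}.
Implicit Types (beta t : R).

Definition frac_part t : R := t - (Num.floor t)%:~R.

(* r_n(t), extended by r_0(t) = t *)
Definition beta_rem beta t (n : nat) : R :=
  iter n (fun r => frac_part (beta * r)) t.

(* x_{i+1}(t); on the nonnegative argument used here [Num.truncn] is the
   integer part. *)
Definition beta_expansion beta t (i : nat) : nat :=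
  Num.truncn (beta * beta_rem beta t i).

End BetaExpansion.

Definition finite_expansion (a : nat -> nat) : Prop :=
  exists m : nat, forall i, (m <= i)%N -> a i = 0%N.

Definition last_nonzero (a : nat -> nat) : nat :=
  xget 0%N [set k : nat | a k <> 0%N /\ forall i, (k < i)%N -> a i = 0%N].

(* With k = last_nonzero (e beta), the first k.+1 digits form the word
   a_1 ... a_{k+1} whose last letter is decreased and which is then repeated. *)
Definition generating_seq {R : realType} (beta : R) (i : nat) : nat :=
  let e := beta_expansion beta 1 in
  if `[< finite_expansion e >] then
    let k := last_nonzero e in
    let j := (i %% k.+1)%N in
    if j == k then (e k).-1 else e j
  else e i.

Definition eventually_periodic_with (a : nat -> nat) (n p : nat) : Prop :=
  (0 < p)%N /\ forall i, (n <= i)%N -> a (i + p)%N = a i.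

Definition eventually_periodic (a : nat -> nat) : Prop :=
  exists n p, eventually_periodic_with a n p.

(* The least preperiod and the least period are attained by a common pair. *)
Definition minimal_periodicity (a : nat -> nat) (n p : nat) : Prop :=
  eventually_periodic_with a n p /\
  forall n' p', eventually_periodic_with a n' p' -> (n <= n')%N /\ (p <= p')%N.

Definition factor (A : Type) (x : int -> A) (k : int) (m : nat) : seq A :=
  [seq x (k + j%:Z) | j <- iota 0 m].

Definition beta_language {R : realType} (beta : R) : set (seq nat) :=
  [set w | exists (t : R) (j : nat), 0 <= t < 1 /\
     w = [seq beta_expansion beta t i | i <- iota j (size w)]].

(* A shift space is determined by its language: it consists of the biinfinite
   sequences all of whose finite factors belong to it. *)
Definition beta_shift {R : realType} (beta : R) : set (int -> nat) :=
  [set x | (forall k, (x k)%:Z < Num.ceil beta) /\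
           (forall k m, beta_language beta (factor x k m))].

Record labelled_graph (A : Type) := LabelledGraph {
  vertex : finType;
  edge : finType;
  source : edge -> vertex;
  target : edge -> vertex;
  label : edge -> A }.

Section LabelledGraphs.
Variable A : Type.
Implicit Types (G : labelled_graph A) (X : set (int -> A)).

Definition biinfinite_path G (pi : int -> edge G) : Prop :=
  forall k, target (pi k) = source (pi (k + 1)).

Definition presented_shift G : set (int -> A) :=
  [set x | exists pi : int -> edge G,
     biinfinite_path pi /\ forall k, x k = label (pi k)].

Definition presentation G X : Prop := X = presented_shift G.

Definition sofic X : Prop := exists G, presentation G X.

Definition right_resolving G : Prop :=
  forall e e' : edge G, source e = source e' -> label e = label e' -> e = e'.

Definition right_fischer_cover G X : Prop :=
  [/\ right_resolving G, presentation G X &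
      forall H, right_resolving H -> presentation H X ->
        (#|vertex G| <= #|vertex H|)%N].

End LabelledGraphs.

(* The graph (F_beta, L_beta) read off from g = generating_seq beta.  The vertex
   v_{i+1} is i : 'I_(n + p) and the edge e_{i+1}^k is Tagged _ k with
   k : 'I_(g i).+1, i.e. 0 <= k <= g i.  For 0 < p the value given to [insubd]
   is always smaller than n + p, so its default is never used. *)
Definition beta_graph (g : nat -> nat) (n p : nat) : labelled_graph nat :=
  @LabelledGraph nat
    'I_(n + p)
    {i : 'I_(n + p) & 'I_(g i).+1}
    (fun e => tag e)
    (fun e => insubd (tag e)
       (if (tagged e < g (tag e))%N then 0%N
        else if ((tag e).+1 < n + p)%N then (tag e).+1
        else n))
    (fun e => tagged e : nat).

(* Main.v *)
(* Renyi's criterion (x lies in the beta-shift iff every ray of x is <= g) follows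
   from monotonicity of t |-> expansion of t.  It implies that the follower sets
   of pasts ending in g_1 ... g_i after a past that constrains nothing are
   { y | all shifts of y are <= g and y <= g_{i+1} g_{i+2} ... }, whose greatest
   element is the i-th shift of g.  A sofic shift has finitely many follower sets
   of pasts, so some shifts of g coincide.  Conversely, the graph presents the
   shift, its vertices having exactly these follower sets.  For minimality, take
   in a right-resolving presentation H a past that can be read up to as few
   vertices as possible: all these vertices then have the follower set of the
   past, and this persists when the past is extended.  Extending by a long block
   of zeros and then by g_1 ... g_i yields n + p vertices of H with pairwise
   distinct follower sets. *)
Require Import Defs.
From mathcomp Require Import all_boot all_order all_algebra.
From mathcomp Require Import all_classical all_reals.
From mathcomp Require Import zify lra.

Import Order.TTheory GRing.Theory Num.Theory.
Local Open Scope ring_scope.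

Set Implicit Arguments.
Unset Strict Implicit.
Unset Printing Implicit Defensive.

(** * Lexicographic order on one-sided sequences *)

Section Lexicographic.
Local Open Scope nat_scope.
Implicit Types a b c g : nat -> nat.

Definition shift T i (a : nat -> T) : nat -> T := fun j => a (i + j).

Definition scons T (d : T) (a : nat -> T) : nat -> T :=
  fun i => if i is j.+1 then a j else d.

(* a <= b in the lexicographic order: there is no first difference at which b is
   smaller. *)
Definition lexle a b : Prop :=
  forall m, (forall i, i < m -> a i = b i) -> a m <= b m.

Lemma lexle_refl a : lexle a a. Proof. by []. Qed.

Lemma lexle_trans b a c : lexle a b -> lexle b c -> lexle a c.
Proof.
move=> ab bc m eac.
have eab i : i < m -> a i = b i.
  elim/ltn_ind: i => i IH im.
  have ei j : j < i -> a j = b j by move=> ji; apply: IH => //; exact: ltn_trans im.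
  apply/eqP; rewrite eqn_leq ab //= eac //.
  by apply: bc => j ji; rewrite -ei // eac //; exact: ltn_trans im.
apply: leq_trans (ab _ eab) (bc _ _) => i im.
by rewrite -eab // eac.
Qed.

Lemma lexle_anti a b : lexle a b -> lexle b a -> a = b.
Proof.
move=> ab ba; apply/funext => i.
elim/ltn_ind: i => i IH.
by apply/eqP; rewrite eqn_leq ab // ba // => j /IH.
Qed.

Lemma lexle_total a b : lexle a b \/ lexle b a.
Proof.
case: (pselect (lexle a b)) => [|nab]; [by left | right].
have [m [eab ltba]] : exists m, (forall i, i < m -> a i = b i) /\ b m < a m.
  apply: contra_notP nab => nex m eab.
  by rewrite leqNgt; apply/negP => ltba; apply: nex; exists m.
move=> m' eba; have [lt|lt|<-] := ltngtP m m'; last exact: ltnW.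
- by move: ltba; rewrite (eba _ lt) ltnn.
- by rewrite (eab _ lt).
Qed.

Lemma lexle_head a b : lexle a b -> a 0 <= b 0.
Proof. exact. Qed.

Lemma lexle_lt a b : a 0 < b 0 -> lexle a b.
Proof.
by move=> lt [|m] e; [exact: ltnW | rewrite e // ltnn in lt].
Qed.

Lemma lexle_tail a b :
  a 0 = b 0 -> lexle a b <-> lexle (shift 1 a) (shift 1 b).
Proof.
move=> e0; split => ab m e; first by apply: ab => -[|i] // /e.
by case: m e => [|m] e; [rewrite e0 | apply: (ab m) => i im; exact: e].
Qed.

Lemma lexle_shift n a b :
  (forall i, i < n -> a i = b i) -> lexle a b -> lexle (shift n a) (shift n b).
Proof.
move=> e ab m em; apply: ab => i im.
have [/e //|ni] := ltnP i n.
by rewrite -(subnKC ni); apply: em; lia.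
Qed.

Lemma lexle_leq a b : (forall i, a i <= b i) -> lexle a b.
Proof. by move=> ab m _. Qed.

Lemma shiftD T i j (a : nat -> T) : shift i (shift j a) = shift (j + i) a.
Proof. by apply/funext => k; rewrite /shift addnA. Qed.

Lemma shift0 T (a : nat -> T) : shift 0 a = a.
Proof. by []. Qed.

Lemma scons_shift1 T (a : nat -> T) : scons (a 0) (shift 1 a) = a.
Proof. by apply/funext => -[|i]. Qed.

End Lexicographic.

(** * Expansions of points of the unit interval and the generating sequence *)

Section BetaExpansions.
Context {R : realType} (beta : R).
Hypothesis beta_gt1 : 1 < beta.
Local Notation rem := (beta_rem beta).
Local Notation exp := (beta_expansion beta).
Local Notation e := (beta_expansion beta 1).
Local Notation g := (generating_seq beta).
Implicit Types s t r : R.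

Let beta_gt0 : 0 < beta. Proof. exact: lt_trans ltr01 beta_gt1. Qed.
Let beta_ge0 : 0 <= beta. Proof. exact: ltW. Qed.

Lemma frac_part_itv r : 0 <= frac_part r < 1.
Proof.
have := floor_itv r; rewrite /frac_part intrD; set f := (Num.floor r)%:~R.
by move=> /andP[? ?]; apply/andP; split; lra.
Qed.

Lemma beta_remD t i j : rem (rem t i) j = rem t (i + j).
Proof. by rewrite /beta_rem addnC iterD. Qed.

Lemma beta_expansion_shift t i : exp (rem t i) = shift i (exp t).
Proof. by apply/funext => j; rewrite /shift /beta_expansion beta_remD. Qed.

Lemma beta_rem_ge0 t i : 0 <= t -> 0 <= rem t i.
Proof. by case: i => // i _; case/andP: (frac_part_itv (beta * rem t i)). Qed.

Lemma beta_remS_lt1 t i : rem t i.+1 < 1.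
Proof. by case/andP: (frac_part_itv (beta * rem t i)). Qed.

Lemma beta_rem_itv t i : 0 <= t < 1 -> 0 <= rem t i < 1.
Proof.
by case: i => // i /andP[t0 _]; rewrite beta_rem_ge0 // beta_remS_lt1.
Qed.

Lemma beta_remS t i : 0 <= t -> beta * rem t i = (exp t i)%:R + rem t i.+1.
Proof.
move=> t0; rewrite /beta_expansion /= /frac_part.
have ge0 : 0 <= beta * rem t i by rewrite mulr_ge0 // beta_rem_ge0.
by rewrite truncn_floor ge0 natr_absz ger0_norm ?floor_ge0 // addrC subrK.
Qed.

(** Equal digits cancel, so each step multiplies the difference of the remainders by [beta].
    Monotonicity of the expansion rests on this. *)
Lemma beta_rem_diff s t m : 0 <= s -> 0 <= t ->
  (forall i, (i < m)%N -> exp s i = exp t i) ->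
  rem t m - rem s m = beta ^+ m * (t - s).
Proof.
move=> s0 t0; elim: m => [|m IH] est; first by rewrite mul1r.
rewrite exprS -mulrA -IH; last by move=> i im; rewrite est // ltnW.
rewrite mulrBr !beta_remS // est //; lra.
Qed.

Lemma lexle_beta_expansion s t : 0 <= s -> s <= t -> lexle (exp s) (exp t).
Proof.
move=> s0 st m est; have t0 := le_trans s0 st.
apply: le_truncn; rewrite ler_pM2l //.
rewrite -subr_ge0 (beta_rem_diff s0 t0 est).
by rewrite mulr_ge0 ?subr_ge0 ?exprn_ge0.
Qed.

Lemma beta_rem0 i : rem 0 i = 0.
Proof. by elim: i => //= i ->; rewrite mulr0 /frac_part floor0 subr0. Qed.

Lemma beta_expansion0 i : exp 0 i = 0%N.
Proof. by rewrite /beta_expansion beta_rem0 mulr0 truncn0. Qed.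

Lemma bernoulli m : 1 + m%:R * (beta - 1) <= beta ^+ m.
Proof.
elim: m => [|m IH]; first by rewrite mul0r addr0.
rewrite exprS -natr1; apply: (le_trans _ (ler_wpM2l beta_ge0 IH)).
have := mulr_ge0 (ler0n R m) (sqr_ge0 (beta - 1)); lra.
Qed.

(** If all digits vanish, the m-th remainder is [beta ^+ m * t]; for t > 0 it eventually exceeds 1,
    by Bernoulli's inequality. *)
Lemma beta_expansion_eq0 t :
  0 <= t < 1 -> (forall i, exp t i = 0%N) -> t = 0.
Proof.
move=> t01 t0; case/andP: (t01) => t_ge0 _.
apply/eqP; rewrite eq_le t_ge0 andbT leNgt; apply/negP => t_gt0.
pose m := Num.bound (((beta - 1) * t)^-1).
have bt_gt0 : 0 < (beta - 1) * t by rewrite mulr_gt0 // subr_gt0.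
have mP : 1 < m%:R * ((beta - 1) * t).
  rewrite -ltr_pdivrMr // mul1r; apply: archi_boundP.
  by rewrite invr_ge0 ltW.
have := @beta_rem_diff 0 t m (lexx 0) t_ge0.
rewrite beta_rem0 !subr0 => dE.
have /andP[_] := beta_rem_itv m t01.
rewrite dE => [|i _]; last by rewrite t0 beta_expansion0.
have := bernoulli m; nra.
Qed.

Lemma beta_expansion1_gt0 : (0 < e 0)%N.
Proof. by rewrite truncn_gt0 /= mulr1 ltW. Qed.

Lemma generating_seq_infinite : ~ finite_expansion e -> g = e.
Proof.
by move=> inf; apply/funext => i; rewrite /generating_seq; case: asboolP.
Qed.

Lemma generating_seq_finite : finite_expansion e ->
  exists k, [/\ (0 < e k)%N, forall i, (k < i)%N -> e i = 0%N,
    rem 1 k.+1 = 0 &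
    forall i, g i = if (i %% k.+1 == k)%N then (e k).-1 else e (i %% k.+1)].
Proof.
move=> fin; pose P k := e k <> 0%N /\ forall i, (k < i)%N -> e i = 0%N.
have [k0 Pk0] : exists k, P k.
  case: (fin) => m; elim: m => [|m IH] e0.
    by have := beta_expansion1_gt0; rewrite e0.
  have [em|em] := eqVneq (e m) 0%N; last by exists m; split=> //; apply/eqP.
  by apply: IH => i; rewrite leq_eqVlt => /predU1P[<-//|]; exact: e0.
have [ek e0] : P (last_nonzero e) by exact: (xgetPex 0%N (ex_intro P k0 Pk0)).
exists (last_nonzero e); split=> //.
- by rewrite lt0n; apply/eqP.
- apply: beta_expansion_eq0 => [|i].
    by rewrite beta_rem_ge0 // beta_remS_lt1.
  by rewrite beta_expansion_shift /shift e0 // ltnS leq_addr.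
- by move=> i; rewrite /generating_seq asboolT.
Qed.

Lemma generating_seq_head_lt : (g 0)%:R < beta.
Proof.
have bE : beta = (e 0)%:R + rem 1 1 by rewrite -beta_remS //= mulr1.
have r1 : 0 <= rem 1 1 by rewrite beta_rem_ge0.
have r1_eq0 : rem 1 1 = 0 -> forall i, (0 < i)%N -> e i = 0%N.
  move=> r0 [//|i] _.
  by rewrite -[e _]/(shift 1 e i) -beta_expansion_shift r0 beta_expansion0.
have [fin|inf] := pselect (finite_expansion e); last first.
  rewrite generating_seq_infinite // [ltRHS]bE ltrDl lt_neqAle r1 andbT eq_sym.
  by apply/eqP => /r1_eq0 e0; apply: inf; exists 1%N => -[|i]; auto.
have [k [ek e0 rk ->]] := generating_seq_finite fin; rewrite mod0n.
(* For k = 0 the number [beta] is the integer [e 0], and g is constantly [beta - 1]; otherwise g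
   starts with [e 0], and [rem 1 1] is nonzero. *)
case: k ek e0 rk => [|k] ek e0 rk /=.
  by rewrite [ltRHS]bE rk addr0 ltr_nat prednK.
rewrite [ltRHS]bE ltrDl lt_neqAle r1 andbT eq_sym.
by apply/eqP => /r1_eq0 e0'; rewrite e0' in ek.
Qed.

Lemma generating_seq_head_gt0 : (0 < g 0)%N.
Proof.
have [fin|inf] := pselect (finite_expansion e); last first.
  by rewrite generating_seq_infinite // beta_expansion1_gt0.
have [k [ek e0 rk ->]] := generating_seq_finite fin; rewrite mod0n.
case: k ek e0 rk => [|k] ek e0 rk /=; last exact: beta_expansion1_gt0.
have := beta_remS 0 (@ler01 R); rewrite rk mulr1 addr0 => bE.
by rewrite -ltnS prednK // -(ltr_nat R) -bE.
Qed.

Lemma lexle_generating_seq : lexle g e.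
Proof.
have [fin|inf] := pselect (finite_expansion e); last first.
  by rewrite generating_seq_infinite.
have [k [ek e0 rk gE]] := generating_seq_finite fin.
move=> m ge; have [mk|km|->] := ltngtP m k.
- by rewrite gE modn_small ?(ltn_eqF mk) // ltnW.
- by have := ge _ km; rewrite gE modn_small // eqxx => eE; move: ek; rewrite -eE; lia.
- by rewrite gE modn_small // eqxx leq_pred.
Qed.

Lemma generating_seq_not_finite : ~ finite_expansion g.
Proof.
have [fin|inf] := pselect (finite_expansion e); last first.
  by rewrite generating_seq_infinite.
have [k [_ _ _ gE]] := generating_seq_finite fin.
case=> m g0; have := generating_seq_head_gt0.
have := g0 (m * k.+1)%N; rewrite gE modnMl -{1}[0%N](mod0n k.+1) -gE => -> //.
by rewrite leq_pmulr.
Qed.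

(** If e is finite, g differs from e within the first period only at its last letter. Strong
    induction on the position compared: agreement over a whole period is removed by replacing t with
    [rem t k.+1], again in [0, 1). *)
Lemma lexle_beta_expansion_generating t : 0 <= t < 1 -> lexle (exp t) g.
Proof.
have [fin|inf] := pselect (finite_expansion e); last first.
  case/andP=> t0 t1; rewrite generating_seq_infinite //.
  by apply: lexle_beta_expansion => //; exact: ltW.
have [k [ek e0 rk gE]] := generating_seq_finite fin.
move=> t01 m; elim/ltn_ind: m t t01 => m IH t /andP[t0 t1] tg.
have te : lexle (exp t) e by apply: lexle_beta_expansion => //; exact: ltW.
have g_lt i : (i < k)%N -> g i = e i.
  by move=> ik; rewrite gE modn_small ?(ltn_eqF ik) // ltnW.
have [mk|km|mk] := ltngtP m k.
- by rewrite g_lt //; apply: te => i im; rewrite -g_lt ?tg //; exact: ltn_trans mk.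
- have g_per i : g (k.+1 + i)%N = g i by rewrite !gE modnDl.
  have := IH (m - k.+1)%N _ (rem t k.+1).
  rewrite beta_expansion_shift /shift -g_per subnKC //; apply.
  + lia.
  + by rewrite beta_rem_ge0 // beta_remS_lt1.
  + by move=> i im; rewrite tg ?g_per //; lia.
- rewrite mk gE modn_small // eqxx -ltnS prednK // ltn_neqAle.
  have tek i : (i < k)%N -> exp t i = e i.
    by move=> ik; rewrite -g_lt // tg // mk.
  rewrite te // andbT; apply/eqP => tk.
  (* The remainder of 1 vanishes after k.+1 steps, that of t < 1 would be < 0. *)
  have := @beta_rem_diff t 1 k.+1 t0 ler01.
  rewrite rk sub0r => dE.
  have : 0 < beta ^+ k.+1 * (1 - t) by rewrite mulr_gt0 ?exprn_gt0 ?subr_gt0.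
  rewrite -dE; first by rewrite oppr_gt0 ltNge beta_rem_ge0.
  by move=> i; rewrite ltnS leq_eqVlt => /predU1P[->|/tek].
Qed.

Lemma generating_seq_shift j : lexle (shift j g) g.
Proof.
have rem1_itv i : 0 <= rem 1 i.+1 < 1 by rewrite beta_rem_ge0 // beta_remS_lt1.
have [fin|inf] := pselect (finite_expansion e); last first.
  case: j => // j; rewrite {1}generating_seq_infinite // -beta_expansion_shift.
  exact: lexle_beta_expansion_generating.
have [k [ek e0 rk gE]] := generating_seq_finite fin.
(* By periodicity only shifts by less than a period matter. Inside the period they are compared
   through the shifts of e, which are expansions of points below 1. *)
have -> : shift j g = shift (j %% k.+1)%N g.
  by apply/funext => i; rewrite /shift !gE modnDml.
have := ltn_pmod j (ltn0Sn k); case: (j %% k.+1)%N => [_|{}j jk]; first exact: lexle_refl.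
have je : lexle (shift j.+1 e) e.
  rewrite -beta_expansion_shift.
  apply: lexle_trans lexle_generating_seq.
  exact: lexle_beta_expansion_generating.
have g_lt i : (i < k)%N -> g i = e i.
  by move=> ik; rewrite gE modn_small ?(ltn_eqF ik) // ltnW.
have gk : g k = (e k).-1 by rewrite gE modn_small // eqxx.
have jge n : (j.+1 + n <= k)%N ->
    (forall i, (i < n)%N -> shift j.+1 g i = g i) -> (e (j.+1 + n) <= e n)%N.
  move=> nk sg; apply: (je n) => i im.
  by have := sg i im; rewrite /shift !g_lt //; lia.
move=> m sg; have [mk|mk|mk] := ltngtP (j.+1 + m)%N k.
- by rewrite /shift !g_lt //; [apply: jge; rewrite // ltnW | lia].
(* Agreement cannot run past the decreased letter: it would make [e (k - j.+1)] equal to [(e k).-1],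
   whereas [jge] bounds it below by [e k]. *)
- have kE : (j.+1 + (k - j.+1))%N = k by lia.
  have := sg (k - j.+1)%N; rewrite /shift kE gk g_lt; last lia.
  have := jge (k - j.+1)%N; rewrite kE leqnn => /(_ isT) jge' sg'.
  suff : (e k <= e (k - j.+1))%N by rewrite -sg'; lia.
  by apply: jge' => i im; apply: sg; lia.
- rewrite /shift mk gk g_lt; last lia.
  by apply: leq_trans (leq_pred _) _; rewrite -{1}mk; apply: jge; rewrite // mk.
Qed.

(* The induction prepends a letter to the expansion of some t' < 1; if the new
   point were >= 1 then e <= a <= g <= e by monotonicity, but g is not finite. *)
Lemma word_expansion m (a : nat -> nat) :
  (forall i, (m <= i)%N -> a i = 0%N) -> (forall j, lexle (shift j a) g) ->
  exists t, 0 <= t < 1 /\ exp t = a.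
Proof.
elim: m a => [|m IH] a a0 ag.
  exists 0; rewrite lexx ltr01; split=> //.
  by apply/funext => i; rewrite beta_expansion0 a0.
have [i im|j|t' [t'01 t'E]] := IH (shift 1 a); first exact: a0.
  by rewrite shiftD.
case/andP: (t'01) => t'0 t'1.
pose t := ((a 0)%:R + t') / beta.
have bt : beta * t = (a 0)%:R + t' by rewrite mulrC divfK // gt_eqF.
have t0 : 0 <= t by rewrite divr_ge0 ?addr_ge0.
have tE0 : exp t 0 = a 0.
  by apply: truncn_def; rewrite /= bt lerDl t'0 -natr1 ltrD2l.
have tE : exp t = a.
  rewrite -(scons_shift1 (exp t)) -(scons_shift1 a) tE0 -t'E.
  rewrite -beta_expansion_shift; congr (scons _ (exp _)).
  by have := beta_remS 0 t0; rewrite tE0 /= bt => /addrI.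
exists t; split=> //; rewrite t0 ltNge; apply/negP => t1.
have ea : lexle e a by rewrite -tE; exact: lexle_beta_expansion.
apply: generating_seq_not_finite; exists m.+1 => i mi.
rewrite -(@lexle_anti a g) ?a0 //; first exact: (ag 0).
exact: lexle_trans lexle_generating_seq ea.
Qed.

End BetaExpansions.

(** * Biinfinite sequences and the lexicographic criterion *)

Definition ray T (x : int -> T) (k : int) : nat -> T := fun i => x (k + i%:Z).

Lemma beta_shiftP {R : realType} (beta : R) x : 1 < beta ->
  beta_shift beta x <-> forall k, lexle (ray x k) (generating_seq beta).
Proof.
move=> beta_gt1; split=> [[_ xB] k m xg|xg].
  have [t [j [t01 xt]]] := xB k m.+1.
  have xE i : (i < m.+1)%N -> x (k + i%:Z) = shift j (beta_expansion beta t) i.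
    move=> im; have := congr1 (fun s => nth 0%N s i) xt.
    by rewrite size_map size_iota !(nth_map 0%N) ?size_iota // !nth_iota.
  have := lexle_beta_expansion_generating beta_gt1 (beta_rem_itv beta j t01).
  rewrite beta_expansion_shift {1}/ray xE //; apply => i im.
  by rewrite -xg // /ray xE // ltnW.
split=> [k|k m].
  have := generating_seq_head_lt beta_gt1.
  rewrite -[_%:R]/((generating_seq beta 0)%:Z%:~R) -ceil_gt_int; apply: le_lt_trans.
  by have := lexle_head (xg k); rewrite /ray addr0 lez_nat.
(* Padding the factor with zeros keeps all its shifts below g, so it is itself the expansion of a
   point. *)
pose a i := if (i < m)%N then x (k + i%:Z) else 0%N.
have [i mi|j|t [t01 tE]] := word_expansion beta_gt1 (m := m) (a := a).
- by rewrite /a ltnNge mi.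
- move=> r ag; rewrite {1}/shift /a; case: ifP => // jrm.
  have := xg (k + j%:Z) r; rewrite /ray PoszD addrA; apply=> i ir.
  rewrite -ag // /shift /a; case: ifP => [_|]; last lia.
  by rewrite PoszD addrA.
exists t, 0%N; split=> //; rewrite tE /Defs.factor size_map size_iota.
apply/eq_in_map => i; rewrite mem_iota /= => im; by rewrite /a im.
Qed.

(* Negz i is -(i + 1), so u lists the past backwards. *)
Definition glue T (u y : nat -> T) : int -> T :=
  fun k => match k with Posz i => y i | Negz i => u i end.

(** The past u after i further letters of y have been read. Pasts are listed backwards, so each new
    letter goes to the front. *)
Fixpoint append T (u y : nat -> T) (i : nat) : nat -> T :=
  if i is j.+1 then scons (y j) (append u y j) else u.

Lemma glue_scons T (d : T) u y k :
  glue (scons d u) y k = glue u (scons d y) (k + 1).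
Proof.
case: k => [i|[|i]] //; first by rewrite -PoszD addn1.
by rewrite (_ : Negz i.+1 + 1 = Negz i) // !NegzE; lia.
Qed.

(** * Pasts and futures of vertices in a labelled graph *)

Section LabelledPaths.
Local Open Scope nat_scope.
Variables (A : Type) (G : labelled_graph A).
Implicit Types (u y : nat -> A) (q : vertex G).

Definition past u q : Prop := exists pi : nat -> edge G,
  [/\ target (pi 0) = q, forall i, target (pi i.+1) = source (pi i) &
      forall i, u i = label (pi i)].

Definition future y q : Prop := exists pi : nat -> edge G,
  [/\ source (pi 0) = q, forall i, target (pi i) = source (pi i.+1) &
      forall i, y i = label (pi i)].

Lemma presented_shift_glue u y :
  presented_shift G (glue u y) <-> exists q, past u q /\ future y q.
Proof.
split=> [[pi [pi_path uyE]]|[q [[pu [qu pu_path uE]] [py [qy py_path yE]]]]].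
  exists (source (pi 0%:Z)); split.
    exists (fun i => pi (Negz i)); split=> [|i|i].
    + exact: pi_path (Negz 0).
    + rewrite pi_path; congr (source (pi _)); rewrite !NegzE; lia.
    + exact: uyE (Negz i).
  exists (fun i => pi (Posz i)); split=> [//|i|i].
  + by rewrite pi_path -PoszD addn1.
  + exact: uyE (Posz i).
exists (glue pu py); split.
  case=> [i|[|i]].
  + by rewrite -PoszD addn1; exact: py_path.
  + by rewrite /= qu qy.
  + by rewrite (_ : (Negz i.+1 + 1)%R = Negz i) ?pu_path // !NegzE; lia.
by case=> i; [exact: yE | exact: uE].
Qed.

Lemma past_scons d u q :
  past (scons d u) q <->
  exists e : edge G, [/\ past u (source e), label e = d & target e = q].
Proof.
split=> [[pi [qE pi_path uE]]|[e [[pi [qE pi_path uE]] ed eq]]].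
  exists (pi 0); split=> //; last by rewrite -(uE 0).
  exists (shift 1 pi); split=> [|i|i]; [exact: pi_path|exact: pi_path|].
  exact: (uE i.+1).
exists (scons e pi); split=> // [[|i]|[|i]] //=; exact: pi_path.
Qed.

Lemma futureP y q :
  future y q <->
  exists e : edge G, [/\ source e = q, label e = y 0 & future (shift 1 y) (target e)].
Proof.
split=> [[pi [qE pi_path yE]]|[e [eq ey [pi [qE pi_path yE]]]]].
  exists (pi 0); split=> //.
  exists (shift 1 pi); split=> [|i|i]; [by rewrite pi_path|exact: pi_path|].
  exact: (yE i.+1).
exists (scons e pi); split=> // [[|i]|[|i]] //=; exact: (yE i).
Qed.

Definition pasts u : {set vertex G} := [set q | `[< past u q >]].

Lemma mem_pasts u q : q \in pasts u <-> past u q.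
Proof. by rewrite inE; split => /asboolP. Qed.

Definition alive u : Prop := exists q y, past u q /\ future y q.

(** This replaces a synchronizing past. A presentation may contain several copies of the same graph,
    so a past leading to a single vertex need not exist. *)
Definition focused u : Prop :=
  alive u /\
  forall v, alive v -> #|pasts u| <= #|pasts v|.

Lemma focused_exists u : alive u -> exists v, focused v.
Proof.
move=> u0; pose P m := `[< exists v, alive v /\ #|pasts v| = m >].
have exP : exists m, P m by exists #|pasts u|; apply/asboolP; exists u.
case: (ex_minnP exP) => m /asboolP[v [v0 vm]] m_min.
exists v; split=> // w w0; rewrite vm; apply: m_min.
by apply/asboolP; exists w.
Qed.

Hypothesis G_res : right_resolving G.

(* Reading d is a partial map on vertices, so it cannot increase the number of
   reachable vertices; by minimality it is defined on all of them. *)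
Lemma focused_scons d u : focused u -> alive (scons d u) ->
  focused (scons d u) /\
  forall q, past u q -> exists e : edge G, source e = q /\ label e = d.
Proof.
move=> [u0 u_min] du0.
pose next q := [pick e : edge G | (source e == q) && `[< label e = d >]].
pose D := [set q in pasts u | next q != None].
pose f q := odflt q (omap (@target _ G) (next q)).
have sub : pasts (scons d u) \subset f @: D.
  apply/fintype.subsetP => q /mem_pasts /past_scons[e [ue ed eq]].
  have nextE : next (source e) = Some e.
    rewrite /next; case: pickP => [e' /andP[/eqP se' /asboolP le']|].
      by congr Some; apply: G_res => //; rewrite le'.
    by move=> /(_ e); rewrite eqxx ed /=; case: asboolP.
  apply/imsetP; exists (source e); last by rewrite /f nextE.
  by rewrite inE nextE andbT; apply/mem_pasts.
have leD : #|pasts (scons d u)| <= #|D|.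
  exact: leq_trans (subset_leq_card sub) (leq_imset_card _ _).
have Du : D \subset pasts u by apply/fintype.subsetP => q; rewrite inE => /andP[].
split.
  split=> // v v0; apply: leq_trans leD _.
  exact: leq_trans (subset_leq_card Du) (u_min _ v0).
have DE : D = pasts u.
  by apply/eqP; rewrite eqEcard Du; exact: leq_trans (u_min _ du0) leD.
move=> q /mem_pasts; rewrite -DE inE => /andP[_].
rewrite /next; case: pickP => // e /andP[/eqP se /asboolP le] _.
by exists e.
Qed.

Lemma past_append u y i :
  (exists q, past u q /\ future y q) ->
  exists q, past (append u y i) q /\ future (shift i y) q.
Proof.
move=> uy; elim: i => //= i [q [uq /futureP[e [es ey eF]]]].
exists (target e); split; last by rewrite -addn1 -shiftD.
by apply/past_scons; exists e; rewrite es ey /shift addn0.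
Qed.

Lemma focused_append u y i : focused u ->
  (exists q, past u q /\ future y q) -> focused (append u y i).
Proof.
move=> uF uy; elim: i => //= i IH.
have [q [qP qF]] := past_append i.+1 uy.
by have [] := focused_scons IH (ex_intro _ q (ex_intro _ _ (conj qP qF))).
Qed.

(** Any vertex reached by a focused past has the whole follower set of that past: every prefix of y
    leaves the past focused, so the next letter can be read from the current vertex, whichever it
    is. *)
Lemma focused_future u y q : focused u -> past u q ->
  presented_shift G (glue u y) -> future y q.
Proof.
move=> uF uq /presented_shift_glue uy.
have [e0 _] : exists e : edge G, True by case: uq => pi _; exists (pi 0).
have nextP i v : past (append u y i) v ->
    exists e : edge G, source e = v /\ label e = y i.
  have [q' q'PF] := past_append i.+1 uy.
  have [|_ reads] := focused_scons (d := y i) (focused_append i uF uy).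
    by exists q', (shift i.+1 y).
  exact: reads.
pose next i v := xget e0 (fun e : edge G => source e = v /\ label e = y i).
have nextE i v : past (append u y i) v ->
    source (next i v) = v /\ label (next i v) = y i.
  by move=> /nextP; exact: (xgetPex e0).
(* The run from q along y; [e0] is only the default value of [xget]. *)
pose st := fix st i := if i is j.+1 then target (next j (st j)) else q.
have stP i : past (append u y i) (st i).
  elim: i => //= i /[dup] sti /nextE[se le].
  by apply/past_scons; exists (next i (st i)); rewrite se le.
exists (fun i => next i (st i)); split=> [|i|i].
- by have [] := nextE _ _ (stP 0).
- by have [->] := nextE _ _ (stP i.+1).
- by have [] := nextE _ _ (stP i).
Qed.

End LabelledPaths.

(** * Preperiods and periods *)

Section Periodicity.
Local Open Scope nat_scope.
Implicit Types a : nat -> nat.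

Lemma eventually_periodic_mul a n p : eventually_periodic_with a n p ->
  forall N i, n <= i -> a (i + N * p) = a i.
Proof.
move=> [_ ap]; elim=> [|N IH] i ni; first by rewrite addn0.
by rewrite mulSn addnCA addnC ap ?IH //; lia.
Qed.

(** Adding [n' * p] to an index from n on does not change the value and leads past n', where p' is a
    period. Hence the least preperiod admits every period. *)
Lemma eventually_periodic_preperiod a n p n' p' :
  eventually_periodic_with a n p -> eventually_periodic_with a n' p' ->
  eventually_periodic_with a n p'.
Proof.
move=> ap [p'0 ap']; split=> // i ni; have [p0 _] := ap.
rewrite -(eventually_periodic_mul ap n'); last lia.
rewrite addnAC ap' ?(eventually_periodic_mul ap) //.
by apply: leq_trans (leq_addl _ _); rewrite leq_pmulr.
Qed.

Lemma minimal_periodicity_exists a :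
  eventually_periodic a -> exists n p, minimal_periodicity a n p.
Proof.
move=> [n1 [p1 ap1]].
pose P n := `[< exists p, eventually_periodic_with a n p >].
have exP : exists n, P n by exists n1; apply/asboolP; exists p1.
case: (ex_minnP exP) => n /asboolP[p2 ap2] n_min.
pose Q p := `[< eventually_periodic_with a n p >].
have exQ : exists p, Q p by exists p2; apply/asboolP.
case: (ex_minnP exQ) => p /asboolP ap p_min.
exists n, p; split=> // n' p' ap'; split.
  by apply: n_min; apply/asboolP; exists p'.
by apply/p_min/asboolP; exact: eventually_periodic_preperiod ap ap'.
Qed.

Lemma eventually_periodic_reduce a n p l : eventually_periodic_with a n p ->
  exists i : 'I_(n + p), shift l a = shift i a.
Proof.
move=> ap; have [p0 apE] := ap; elim/ltn_ind: l => l IH.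
have [lnp|npl] := ltnP l (n + p); first by exists (Ordinal lnp).
have [|i iE] := IH (l - p); first lia.
exists i; rewrite -iE; apply/funext => j; rewrite /shift -[RHS]apE; last lia.
by congr a; lia.
Qed.

Lemma shift_eq_periodic a i j : i < j -> shift i a = shift j a ->
  eventually_periodic_with a i (j - i).
Proof.
move=> ij aij; split=> [|r ir]; first by rewrite subn_gt0.
have := congr1 (@^~ (r - i)) aij; rewrite /shift /= subnKC // => ->.
by congr a; lia.
Qed.

(** Equal shifts at i < j give preperiod i and period j - i, whence n + p <= j by minimality. *)
Lemma minimal_periodicity_inj a n p i j : minimal_periodicity a n p ->
  i < n + p -> j < n + p -> shift i a = shift j a -> i = j.
Proof.
move=> [_ a_min].
wlog ij : i j / i < j.
  by move=> H ia ja; have [lt|lt|//] := ltngtP i j => aij; [|symmetry]; apply: H.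
move=> _ jnp /(shift_eq_periodic ij)/a_min[]; lia.
Qed.

Lemma not_injective_finType (T : finType) (f : nat -> T) :
  exists i j, i < j /\ f i = f j.
Proof.
apply: contrapT => nf.
have /leq_card : injective (fun i : 'I_(#|T|.+1) => f i).
  move=> i j fij; apply/val_inj; have [lt|lt|//] := ltngtP (i : nat) j.
    by case: nf; exists i, j.
  by case: nf; exists j, i.
by rewrite card_ord ltnn.
Qed.

End Periodicity.

(** * Follower sets in the shift bounded by g *)

Section LexShift.
Local Open Scope nat_scope.
Variable g : nat -> nat.
Hypotheses (g_head : 0 < g 0) (g_fin : ~ finite_expansion g).
Hypothesis g_shift : forall j, lexle (shift j g) g.
Implicit Types (u y z : nat -> nat).

Definition lex_shift : set (int -> nat) := fun x => forall k, lexle (ray x k) g.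

Definition follow u : set (nat -> nat) := fun y => lex_shift (glue u y).

(* The follower set of v_{i+1}; its greatest element is shift i g. *)
Definition lex_tail i : set (nat -> nat) :=
  fun y => (forall j, lexle (shift j y) g) /\ lexle y (shift i g).

Lemma ray_glue_Posz u y (i : nat) : ray (glue u y) i%:Z = shift i y.
Proof. by []. Qed.

Lemma ray_glue_Negz u y (j i : nat) :
  ray (glue u y) (Negz j) i = if i <= j then u (j - i) else y (i - j.+1).
Proof.
rewrite /ray; case: leqP => ij.
  by rewrite (_ : (Negz j + i%:Z)%R = Negz (j - i)) // !NegzE; lia.
by rewrite (_ : (Negz j + i%:Z)%R = Posz (i - j.+1)) // !NegzE; lia.
Qed.

Lemma follow_scons u d y : follow (scons d u) y <-> follow u (scons d y).
Proof.
have rE k : ray (glue (scons d u) y) k = ray (glue u (scons d y)) (k + 1)%R.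
  by apply/funext => i; rewrite /ray glue_scons addrAC.
split=> xg k; last by rewrite rE.
by rewrite -(subrK 1%R k) -rE.
Qed.

Lemma lex_tail0 y : lex_tail 0 y <-> forall j, lexle (shift j y) g.
Proof. by split=> [[]//|yg]; split=> //; exact: (yg 0). Qed.

Lemma lex_tail_shift i : lex_tail i (shift i g).
Proof. by split=> // j; rewrite shiftD. Qed.

Lemma lex_tail_inj i j : lex_tail i = lex_tail j -> shift i g = shift j g.
Proof.
move=> ij; have [_ le_ij] : lex_tail j (shift i g) by rewrite -ij; exact: lex_tail_shift.
have [_ le_ji] : lex_tail i (shift j g) by rewrite ij; exact: lex_tail_shift.
exact: lexle_anti.
Qed.

(** After the letter [g i], the bound by [shift i g] passes to the tail. The bound by g on the
    extended sequence follows, since [shift i g] is at most g. *)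
Lemma follow_scons_tail u i :
  follow u = lex_tail i -> follow (scons (g i) u) = lex_tail i.+1.
Proof.
move=> uE; apply/funext => y; apply/propext; rewrite follow_scons uE /lex_tail.
have tailE : lexle (scons (g i) y) (shift i g) <-> lexle y (shift i.+1 g).
  by rewrite lexle_tail ?shiftD ?addn1 // /shift addn0.
split=> -[yg /tailE yi]; split=> //; first by move=> j; exact: (yg j.+1).
by case=> [|j]; [exact: lexle_trans yi _ | exact: yg].
Qed.

Lemma follow_append u i :
  follow u = lex_tail 0 -> follow (append u g i) = lex_tail i.
Proof. by move=> u0; elim: i => //= i; exact: follow_scons_tail. Qed.

(** A ray starting in the past begins with 0 < [g 0], so the past constrains nothing. *)
Lemma follow_zeros : follow (fun=> 0) = lex_tail 0.
Proof.
apply/funext => y; apply/propext; rewrite lex_tail0; split=> yg.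
  by move=> j; exact: (yg (Posz j)).
case=> j; first by rewrite ray_glue_Posz.
by apply: lexle_lt; rewrite ray_glue_Negz.
Qed.

Lemma lex_shift_zeros : lex_shift (glue (fun=> 0) (fun=> 0)).
Proof.
suff : follow (fun=> 0) (fun=> 0) by [].
by rewrite follow_zeros lex_tail0 => j; exact: lexle_leq.
Qed.

Lemma follow_zero_future u y : follow u y -> follow u (fun=> 0).
Proof.
move=> uy k; apply: lexle_trans (uy k); apply: lexle_leq => i.
by rewrite /ray /glue; case: (k + _)%R.
Qed.

(* A block of zeros longer than any such block in g forgets the past. *)
Lemma follow_append_zeros m u : (forall i, exists2 j, j < m & g (i + j) != 0) ->
  (exists y, follow u y) -> follow (append u (fun=> 0) m) = lex_tail 0.
Proof.
move=> gm [y0 uy0]; apply/funext => y; apply/propext; rewrite lex_tail0.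
pose w n i := if i < n then 0 else y (i - n).
have wS n : scons 0 (w n) = w n.+1 by apply/funext => -[|i].
have -> : follow (append u (fun=> 0) m) y <-> follow u (w m).
  have -> : y = w 0 by apply/funext => i; rewrite /w subn0.
  suff wE k n : follow (append u (fun=> 0) k) (w n) <-> follow u (w (k + n)).
    by rewrite wE addn0.
  by elim: k n => //= k IH n; rewrite follow_scons wS IH addnS.
split=> [uw j|yg].
  have := uw (Posz (m + j)); rewrite ray_glue_Posz; congr lexle.
  apply/funext => i; rewrite /shift /w ltnNge -addnA leq_addr /=.
  by rewrite addKn.
case=> j.
  rewrite ray_glue_Posz; have [jm|mj] := ltnP j m.
    by apply: lexle_lt; rewrite /shift /w addn0 jm.
  rewrite (_ : shift j (w m) = shift (j - m) y) //.
  apply/funext => i; rewrite /shift /w ltnNge (leq_trans mj (leq_addr _ _)) /=.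
  by rewrite addnBAC.
(* A ray starting in u: at positions in u the bound comes from the admissible [y0]; in the zero
   block it is trivial; agreement with g beyond the block would put m consecutive zeros in g. *)
move=> r wg; rewrite ray_glue_Negz; case: (leqP r j) => rj.
  have := uy0 (Negz j) r; rewrite ray_glue_Negz rj; apply=> i ir.
  by rewrite -wg // !ray_glue_Negz (leq_trans (ltnW ir) rj).
rewrite /w; case: (ltnP _ m) => // mr.
have [i im /eqP[]] := gm j.+1.
rewrite -wg; last lia.
rewrite ray_glue_Negz leqNgt ltnS leq_addr /= addKn /w im //.
Qed.

Lemma sofic_lex_shift_periodic : sofic lex_shift -> eventually_periodic g.
Proof.
move=> [G GP]; pose u i := append (fun=> 0) g i.
have uE i : follow (u i) = lex_tail i by apply: follow_append; exact: follow_zeros.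
(* The set of vertices a past can reach determines its follower set, and there are finitely many
   such sets. *)
have [i [j [ij uij]]] := not_injective_finType (fun i => pasts G (u i)).
exists i, (j - i); apply: shift_eq_periodic => //; apply: lex_tail_inj.
rewrite -!uE /follow GP; apply/funext => y; apply/propext.
by rewrite !presented_shift_glue; split=> -[q [/mem_pasts qP qF]]; exists q;
  split=> //; apply/mem_pasts; rewrite ?uij // -uij.
Qed.

(** * The graph of g for the minimal preperiod and period *)

Section MinimalPeriod.
Variables n p : nat.
Hypothesis g_min : minimal_periodicity g n p.
Local Notation G := (beta_graph g n p).

Let g_per : eventually_periodic_with g n p. Proof. by case: g_min. Qed.
Let p_gt0 : 0 < p. Proof. by case: g_per. Qed.

Lemma beta_graph_target_lt (e : edge G) :
  label e < g (source e) -> target e = 0 :> nat.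
Proof. by move=> /= ->; rewrite val_insubd; case: ifP => //; lia. Qed.

(** Only the edge returning from the last vertex needs an argument: there periodicity identifies the
    shifts by n and n + p. *)
Lemma beta_graph_target_eq (e : edge G) : label e = g (source e) ->
  shift (target e) g = shift (source e).+1 g.
Proof.
case: e => i d /= dE; rewrite dE ltnn val_insubd.
have [lt|ge] := ltnP i.+1 (n + p); first by rewrite ?lt.
rewrite -{1}[n]addn0 ltn_add2l p_gt0.
have iE : i.+1 = n + p by apply/eqP; rewrite eqn_leq ge ltn_ord.
apply/funext => j; rewrite iE /shift addnAC; symmetry.
by case: g_per => _; apply; exact: leq_addr.
Qed.

Lemma beta_graph_label_le (e : edge G) : label e <= g (source e).
Proof. by rewrite -ltnS; exact: ltn_ord. Qed.

Lemma beta_graph_right_resolving : right_resolving G.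
Proof.
move=> [i d] [i' d'] /= ii'; move: d'; rewrite -ii' => d' dd'.
by congr Tagged; exact: val_inj.
Qed.

Lemma presented_shift_sub_lex x : presented_shift G x -> lex_shift x.
Proof.
move=> [pi [pi_path xE]] k.
(* It suffices to bound the ray by the shift of g at its starting vertex: while the two agree, the
   path takes edges of maximal label and its vertices follow that shift. *)
apply: lexle_trans (@g_shift (source (pi k))) => m.
elim: m k => [|m IH] k xg.
  by rewrite /ray addr0 xE /shift addn0 beta_graph_label_le.
have rS i : ray x k i.+1 = ray x (k + 1)%R i.
  by rewrite /ray -addrA -PoszD add1n.
have e0 : label (pi k) = g (source (pi k)).
  by have := xg 0 isT; rewrite /ray addr0 xE /shift addn0.
have tE := beta_graph_target_eq e0; rewrite pi_path in tE.
have sS i : shift (source (pi k)) g i.+1 = shift (source (pi (k + 1)%R)) g i.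
  by rewrite tE /shift addSnnS.
by rewrite rS sS; apply: IH => i im; rewrite -rS -sS; apply: xg.
Qed.

(* The vertex reached before reading x_k is the lexicographically least shift
   of g by the length of a prefix of g that is a suffix of x_{k-1}. *)
Lemma lex_sub_presented_shift x : lex_shift x -> presented_shift G x.
Proof.
move=> xg.
pose reads (k : int) (l : nat) := forall j, j < l -> x (k - l%:Z + j%:Z)%R = g j.
pose P k (i : 'I_(n + p)) := `[< exists2 l, reads k l & shift l g = shift i g >].
pose le (i j : 'I_(n + p)) := `[< lexle (shift i g) (shift j g) >].
have np0 : 0 < n + p by rewrite addn_gt0 p_gt0 orbT.
have P0 k : P k (Ordinal np0) by apply/asboolP; exists 0.
(* The lengths l are unbounded, but the shifts of g are represented by finitely many vertices, so a
   least one exists. *)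
have /choice[st stP] : forall k, exists i : 'I_(n + p), P k i /\
    forall l, reads k l -> lexle (shift i g) (shift l g).
  move=> k; have [| | |i Pi i_min] :=
    @extremumP _ _ le (Ordinal np0) (P k) id _ _ _ (P0 k).
  - by move=> i; apply/asboolP.
  - move=> j i r /asboolP ij /asboolP jr; apply/asboolP; exact: lexle_trans jr.
  - by move=> i j; apply/orP; have [?|?] := lexle_total (shift i g) (shift j g);
      [left|right]; apply/asboolP.
  exists i; split=> // l kl; have [j lj] := eventually_periodic_reduce l g_per.
  rewrite lj; apply/asboolP; apply: i_min.
  by apply/asboolP; exists l.
have readsS k l : reads (k + 1)%R l.+1 <-> reads k l /\ x k = g l.
  have iE j : (k + 1 - l.+1%:Z + j%:Z = k - l%:Z + j%:Z)%R by lia.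
  split=> [kl|[kl xl] j].
    split=> [j jl|]; first by rewrite -iE kl // ltnW.
    by rewrite -kl //; congr x; lia.
  rewrite iE ltnS leq_eqVlt => /predU1P[->|/kl //].
  by rewrite -xl; congr x; lia.
have st_le k : lexle (ray x k) (shift (st k) g).
  have [/asboolP[l kl <-] _] := stP k.
  have -> : ray x k = shift l (ray x (k - l%:Z)%R).
    by apply/funext => j; rewrite /ray /shift; congr x; lia.
  exact: lexle_shift kl (xg _).
have x_le k : x k <= g (st k).
  by have := lexle_head (st_le k); rewrite /ray addr0 /shift addn0.
pose pi k : edge G :=
  Tagged (fun i : 'I_(n + p) => 'I_(g i).+1) (inord (x k) : 'I_(g (st k)).+1).
have sE k : source (pi k) = st k by [].
have lE k : label (pi k) = x k by rewrite /= inordK // ltnS.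
exists pi; split=> [k|k]; last by rewrite lE.
rewrite sE; apply/val_inj/(minimal_periodicity_inj g_min (ltn_ord _) (ltn_ord _)).
have [Pst st_min] := stP (k + 1)%R; have [/asboolP[l kl lst] stk_min] := stP k.
have step_eq : x k = g (st k) ->
    shift (target (pi k)) g = shift 1 (shift (st k) g).
  by move=> xk; rewrite beta_graph_target_eq ?lE // shiftD addn1.
(* A nonempty prefix of g ending at x_k extends one ending at x_{k-1}, which the choice of [st k]
   bounds below; for the empty prefix the bound is g itself. Conversely, the target is a candidate
   for [st (k + 1)]: the prefix for [st k] is extended if x_k is the maximal label, and the empty
   one is used otherwise. *)
apply: lexle_anti.
  move/asboolP: Pst => [[|l'] + <-].
    by move=> _; rewrite shift0; exact: g_shift.
  move=> /readsS[kl' xl'].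
  have le_l' := stk_min _ kl'.
  have xk : x k = g (st k).
    apply/eqP; rewrite eqn_leq x_le /= xl'.
    by have := lexle_head le_l'; rewrite /shift !addn0.
  have e0 : shift (st k) g 0 = shift l' g 0 by rewrite /shift !addn0 -xl' xk.
  rewrite step_eq // -[l'.+1]addn1 -shiftD.
  exact: (lexle_tail e0).1 le_l'.
have := x_le k; rewrite leq_eqVlt => /predU1P[xk|xk].
  rewrite step_eq // -lst shiftD addn1; apply: st_min; apply/readsS; split=> //.
  by rewrite xk; have := congr1 (@^~ 0) lst; rewrite /shift /= !addn0.
by rewrite (beta_graph_target_lt (e := pi k)) ?lE //; exact: st_min.
Qed.

Lemma beta_graph_presentation : presentation G lex_shift.
Proof.
apply/funext => x; apply/propext.
by split; [exact: lex_sub_presented_shift | exact: presented_shift_sub_lex].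
Qed.

Lemma beta_graph_minimal H :
  right_resolving H -> presentation H lex_shift -> #|vertex G| <= #|vertex H|.
Proof.
move=> H_res HP.
have followP u y : follow u y <-> exists q : vertex H, past u q /\ future y q.
  by rewrite /follow HP; exact: presented_shift_glue.
have [u0 u0F] : exists u, focused H u.
  have /followP[q qPF] : follow (fun=> 0) (fun=> 0) := lex_shift_zeros.
  by apply: (@focused_exists _ H (fun=> 0)); exists q, (fun=> 0).
(* A window of n + p zeros would contain a full period beyond the preperiod, making g finite. Here t
   locates r modulo p in that period; adding [(i + n) * p] first keeps the subtraction from
   truncating. *)
have gaps i : exists2 j, j < n + p & g (i + j) != 0.
  apply: contrapT => g0; apply: g_fin; exists n => r nr.
  pose t := (r + (i + n) * p - (i + n)) %% p.
  have rE : r + (i + n) * p = i + (n + t) + (r + (i + n) * p - (i + n)) %/ p * p.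
    have := divn_eq (r + (i + n) * p - (i + n)) p; rewrite -/t.
    have : i + n <= (i + n) * p by rewrite leq_pmulr.
    lia.
  rewrite -(eventually_periodic_mul g_per (i + n)) // rE.
  rewrite (eventually_periodic_mul g_per); last lia.
  apply/eqP; apply: contra_notT g0 => git; exists (n + t) => //.
  by rewrite ltn_add2l ltn_pmod.
have [y0 u0y0] : exists y, follow u0 y.
  by have [[q [y [qP yF]]] _] := u0F; exists y; apply/followP; exists q.
pose u := append u0 (fun=> 0) (n + p).
have uE : follow u = lex_tail 0.
  by apply: follow_append_zeros => //; exists y0.
have uF : focused H u.
  apply: focused_append => //; apply/followP.
  exact: follow_zero_future u0y0.
(* Any vertex reached by the focused past ending in the first i letters of g will do. *)
have vF (i : 'I_(n + p)) : exists q : vertex H,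
    forall y, future y q <-> lex_tail i y.
  have uiE : follow (append u g i) = lex_tail i by exact: follow_append.
  have uiF : focused H (append u g i).
    apply: focused_append => //; apply/followP; rewrite uE.
    exact: lex_tail_shift.
  have [[q [_ [qP _]]] _] := uiF; exists q => y; rewrite -uiE followP; split.
    by move=> yF; exists q.
  by move=> /followP uy; apply: focused_future uiF qP _ => //; rewrite -HP.
have [f fP] := choice vF.
have /leq_card : injective f.
  move=> i j fij; apply/val_inj/(minimal_periodicity_inj g_min (ltn_ord _) (ltn_ord _)).
  apply: lex_tail_inj; apply/funext => y; apply/propext.
  by rewrite -!fP fij.
by rewrite /= card_ord.
Qed.

End MinimalPeriod.

End LexShift.

Theorem proposition4p5 (R : realType) (beta : R) (hbeta : 1 < beta) :
  (sofic (beta_shift beta) <-> eventually_periodic (generating_seq beta)) /\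
  (forall n p : nat, minimal_periodicity (generating_seq beta) n p ->
     right_fischer_cover (beta_graph (generating_seq beta) n p)
                         (beta_shift beta)).
Proof.
have g_head := generating_seq_head_gt0 hbeta.
have g_fin := generating_seq_not_finite hbeta.
have g_shift := generating_seq_shift hbeta.
have -> : beta_shift beta = lex_shift (generating_seq beta).
  by apply/funext => x; apply/propext; exact: beta_shiftP.
split; last first.
  move=> n p g_min; split.
  - exact: beta_graph_right_resolving.
  - exact: beta_graph_presentation.
  - by move=> H; exact: beta_graph_minimal.
split; first exact: sofic_lex_shift_periodic.
move=> /minimal_periodicity_exists[n [p g_min]].
by exists (beta_graph (generating_seq beta) n p); exact: beta_graph_presentation.
Qed.
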